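(* Let $m,n,r\ge1$ be integers and let $\mathbb{B}_0,\mathbb{B}_1$ and $\mathscr{G}(\mathcal{F})$ be as defined in the context. For all $\mathcal{F}\in\mathtt{S}^m(\mathbb{C}^{n+1})$, if $G\in\mathscr{G}(\mathcal{F})$, then for all $\alpha\in\mathbb{B}_1$ and for all $\gamma\in\mathbb{N}^n$ with $|\gamma|+|\alpha|\le m$, we have $$\mathcal{F}_{\alpha+\gamma}=\sum_{\beta\in\mathbb{B}_0}G(\beta,\alpha)\,\mathcal{F}_{\beta+\gamma}.$$
   Context: $\mathtt{S}^m(\mathbb{C}^{n+1})$ is the space of symmetric tensors $\mathcal{F}=(\mathcal{F}_{i_1\ldots i_m})_{0\le i_1,\ldots,i_m\le n}$ with complex entries. For $k\in\mathbb{Z}$, $\mathbb{N}^n_k=\{\alpha\in\mathbb{N}^n: |\alpha|\le k\}$ with $|\alpha|=\alpha_1+\cdots+\alpha_n$. For $\alpha\in\mathbb{N}^n_m$ one writes $\mathcal{F}_\alpha:=\mathcal{F}_{i_1\ldots i_m}$ whenever $x_{i_1}\cdots x_{i_m}=x^\alpha:=x_1^{\alpha_1}\cdots x_n^{\alpha_n}$ with $x_0:=1$. For $p=\sum_{\alpha\in\mathbb{N}^n_m}p_\alpha x^\alpha$, $\langle p,\mathcal{F}\rangle:=\sum_{\alpha\in\mathbb{N}^n_m}p_\alpha\mathcal{F}_\alpha$. $\mathbb{B}_0$ is the set of the first $r$ monomials in $x=(x_1,\ldots,x_n)$ in the graded lexicographic order $1, x_1,\ldots,x_n,x_1^2,x_1x_2,\ldots$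 (lower degree first; in equal degree $x^\alpha$ precedes $x^\beta$ if the leftmost nonzero entry of $\alpha-\beta$ is positive). $\mathbb{B}_1:=(\mathbb{B}_0\cup x_1\mathbb{B}_0\cup\cdots\cup x_n\mathbb{B}_0)\setminus\mathbb{B}_0$. Write $\beta\in\mathbb{B}_0$ (resp. $\alpha\in\mathbb{B}_1$) for $x^\beta\in\mathbb{B}_0$ (resp. $x^\alpha\in\mathbb{B}_1$). For $G\in\mathbb{C}^{\mathbb{B}_0\times\mathbb{B}_1}$ and $\alpha\in\mathbb{B}_1$, $\varphi[G,\alpha]:=\sum_{\beta\in\mathbb{B}_0}G(\beta,\alpha)x^\beta-x^\alpha$. $\mathscr{G}(\mathcal{F})$ is the set of generating matrices for $\mathcal{F}$, i.e. of all $G\in\mathbb{C}^{\mathbb{B}_0\times\mathbb{B}_1}$ with $\langle \varphi[G,\alpha]\cdot x^\gamma,\mathcal{F}\rangle=0$ for all $\alpha\in\mathbb{B}_1$ and all $\gamma\in\mathbb{N}^n_{m-|\alpha|}$. *)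

(* Defs.v *)
From mathcomp Require Import all_boot all_order all_algebra perm finmap.
From mathcomp Require Import complex reals.
From mathcomp Require Export mpoly.

Set Implicit Arguments.
Unset Strict Implicit.
Unset Printing Implicit Defensive.

Import GRing.Theory Num.Theory.
Local Open Scope ring_scope.
Local Open Scope fset_scope.

(* A monomial x^alpha is represented by its exponent alpha : 'X_{1..n}, so
   that the product of monomials is the addition of exponents (scope %MM).  *)

Section Tensors.
Variables (m n : nat) (C : comNzRingType).

Definition symmetric_tensor (F : m.-tuple 'I_n.+1 -> C) : Prop :=
  forall (s : 'S_m) (t : m.-tuple 'I_n.+1), F [tuple tnth t (s k) | k < m] = F t.

(* x_i with x_0 := 1; the variables x_1, ..., x_n are indexed by 'I_n. *)
Definition hvar (i : 'I_n.+1) : 'X_{1..n} :=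
  if unlift ord0 i is Some j then U_(j)%MM else 0%MM.

Definition index_mon (t : m.-tuple 'I_n.+1) : 'X_{1..n} :=
  (\sum_(i <- t) hvar i)%MM.

(* F_alpha. For |alpha| <= m some t satisfies index_mon t = alpha, and the
   choice of t does not matter when F is symmetric (see tcoefE); the default
   value 0 is only taken when m < |alpha|. *)
Definition tcoef (F : m.-tuple 'I_n.+1 -> C) (a : 'X_{1..n}) : C :=
  if [pick t : m.-tuple 'I_n.+1 | index_mon t == a] is Some t then F t else 0.

(* <p, F>, meant for p of degree at most m. *)
Definition pairing (p : {mpoly C[n]}) (F : m.-tuple 'I_n.+1 -> C) : C :=
  \sum_(a : 'X_{1..n < m.+1}) p@_a * tcoef F a.

Lemma hvarE (i : 'I_n.+1) (j : 'I_n) : hvar i j = (i == lift ord0 j) :> nat.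
Proof.
rewrite /hvar; case: unliftP => [k ->|->]; last by rewrite mnm0E.
by rewrite mnm1E (inj_eq lift_inj).
Qed.

Lemma index_monE (t : m.-tuple 'I_n.+1) (j : 'I_n) :
  index_mon t j = count_mem (lift ord0 j) t.
Proof.
rewrite /index_mon mnm_sumE -sum1_count [RHS]big_mkcond /=.
by apply: eq_bigr => i _; rewrite hvarE; case: eqP.
Qed.

Lemma index_mon_perm (t u : m.-tuple 'I_n.+1) :
  index_mon t = index_mon u -> perm_eq t u.
Proof.
move=> eq_tu; pose c (v : m.-tuple 'I_n.+1) i := count_mem i v.
have sum_c v : (\sum_i c v i = m)%N.
  rewrite -[RHS](size_tuple v) -sum1_size /c.
  under eq_bigr => i _ do rewrite -sum1_count big_mkcond /=.
  rewrite exchange_big /=; apply: eq_bigr => i _.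
  by rewrite (bigD1 i) //= eqxx big1 ?addn0 // => k /negPf; rewrite eq_sym => ->.
have cS j : c t (lift ord0 j) = c u (lift ord0 j) by rewrite /c -!index_monE eq_tu.
apply/allP => i _ /=; apply/eqP; rewrite -!/(c _ i).
case: (unliftP ord0 i) => [j ->|->]; first exact: cS.
have := sum_c t; rewrite -(sum_c u) !big_ord_recl.
by under eq_bigr => j _ do rewrite cS; move/addIn.
Qed.

Lemma tcoefE (F : m.-tuple 'I_n.+1 -> C) (t : m.-tuple 'I_n.+1) :
  symmetric_tensor F -> tcoef F (index_mon t) = F t.
Proof.
move=> symF; rewrite /tcoef; case: pickP => [u /eqP eq_ut|/(_ t)]; last first.
  by rewrite eqxx.
have /tuple_permP[s eq_us] := index_mon_perm eq_ut.
by rewrite -(symF s t); congr F; apply: val_inj.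
Qed.

End Tensors.

(* The order in which x_1 ^ 2 precedes x_1 x_2; it differs from the order of
   the multinomials library on exponents of equal degree. *)
Definition grlex_lt n (a b : 'X_{1..n}) : bool :=
  (mdeg a < mdeg b)%N ||
  (mdeg a == mdeg b) &&
    [exists i : 'I_n, [forall (j : 'I_n | (j < i)%N), a j == b j] && (b i < a i)%N].

Definition grlex_le n (a b : 'X_{1..n}) : bool := (a == b) || grlex_lt a b.

(* The first r monomials: for n >= 1 there are at least r monomials of degree
   less than r, and they precede all the others. *)
Definition B0 n r : {fset 'X_{1..n}} :=
  [fset a in take r (sort (@grlex_le n) [seq bmnm b | b : 'X_{1..n < r}])].

Definition B1 n r : {fset 'X_{1..n}} :=
  (B0 n r `|` [fset (U_(i) + b)%MM | i in 'I_n, b in B0 n r]) `\` B0 n r.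

(* N^n_k, where k may be negative. *)
Definition Nk n (k : int) (g : 'X_{1..n}) : bool := (mdeg g)%:Z <= k.

Section GeneratingMatrices.
Variables (m n r : nat) (C : comNzRingType).

Definition phi (G : {ffun B0 n r * B1 n r -> C}) (a : B1 n r) : {mpoly C[n]} :=
  \sum_(b : B0 n r) G (b, a) *: 'X_[val b] - 'X_[val a].

Definition generating_matrix
    (F : m.-tuple 'I_n.+1 -> C) (G : {ffun B0 n r * B1 n r -> C}) : Prop :=
  forall (a : B1 n r) (g : 'X_{1..n}), Nk (m%:Z - (mdeg (val a))%:Z) g ->
    pairing (phi G a * 'X_[g]) F = 0.

End GeneratingMatrices.

(* Main.v *)
Require Import Defs.
From mathcomp Require Import all_boot all_order all_algebra finmap.
From mathcomp Require Import complex reals.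

(** Pairing [phi G a * 'X_[g]] with [F] gives, by linearity, the right-hand
    side of the recurrence minus its left-hand side, and this number vanishes
    because [G] is a generating matrix. The one thing to check is that the
    pairing really sees every term: it reads only the coefficients of degree at
    most [m], so each product [val b + g] must have degree at most [m]. It does,
    because [mdeg (val b) <= mdeg (val a)] whenever [b] is in [B0] and [a] is in
    [B1] ([mdeg_B0_le_B1]): [B0] is an initial segment of the monomials for a
    graded order and [a] lies outside it. *)

Import GRing.Theory Num.Theory.
Local Open Scope ring_scope.
Local Open Scope fset_scope.

(** Totality is what makes [sort] return a sorted list. Two distinct exponents
    of equal degree are compared at the first variable where they differ. *)
Lemma grlex_le_total n : total (@grlex_le n).
Proof.
move=> a b; rewrite /grlex_le /grlex_lt.
case: (eqVneq a b) => [//|neq_ab] /=.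
case: (ltngtP (mdeg a) (mdeg b)) => //= _; rewrite ?orbT //.
have [i0 neq_i0] : exists i, a i != b i.
  apply/existsP; apply: contraNT neq_ab => /existsPn eq_ab.
  by apply/eqP/mnmP => i; apply/eqP; rewrite -[_ == _]negbK.
case: (@arg_minnP _ i0 (fun i => a i != b i) val neq_i0) => i neq_i min_i.
have eq_before (j : 'I_n) : (j < i)%N -> a j = b j.
  by rewrite ltnNge => /negP nle_ij; apply/eqP/negP => /negP /min_i.
case: (ltngtP (a i) (b i)) neq_i => // lt_i _; apply/orP; [right|left];
  apply/existsP; exists i; rewrite lt_i andbT; apply/forall_inP => j /eq_before ->;
  exact: eqxx.
Qed.

Lemma grlex_le_mdeg n (a b : 'X_{1..n}) : grlex_le a b -> (mdeg a <= mdeg b)%N.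
Proof.
by case/orP => [/eqP -> //|/orP[/ltnW //|/andP[/eqP -> _]]].
Qed.

(** The list whose first [r] entries form [B0] is finite, so a monomial outside
    [B0] is either too large in degree to be listed or listed later. *)
Lemma mdeg_B0_le_notin n r (a b : 'X_{1..n}) :
  b \in B0 n r -> a \notin B0 n r -> (mdeg b <= mdeg a)%N.
Proof.
rewrite !inE /=; set s := sort _ _ => b_in a_notin.
have mem_s c : c \in s -> (mdeg c < r)%N.
  by rewrite mem_sort => /mapP[d _ ->]; exact: bmdeg.
have [ge_r|lt_r] := leqP r (mdeg a).
  by apply: leq_trans ge_r; apply: ltnW; apply/mem_s/(mem_take b_in).
have a_in : a \in drop r s.
  have : a \in s.
    by rewrite mem_sort; apply/mapP; exists (BMultinom lt_r); rewrite ?mem_enum.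
  by rewrite -{1}(cat_take_drop r s) mem_cat (negPf a_notin).
have : sorted (fun c d : 'X_{1..n} => mdeg c <= mdeg d)%N s.
  apply: (sub_sorted (@grlex_le_mdeg n)).
  exact/sort_sorted/grlex_le_total.
rewrite sorted_pairwise; last by move=> y x z; exact: leq_trans.
by rewrite -{1}(cat_take_drop r s) pairwise_cat => /andP[/allrelP/(_ b a b_in a_in)].
Qed.

Lemma mdeg_B0_le_B1 n r (a : B1 n r) (b : B0 n r) :
  (mdeg (val b) <= mdeg (val a))%N.
Proof.
apply: mdeg_B0_le_notin; first exact: fsvalP.
by have := fsvalP a; rewrite in_fsetD => /andP[].
Qed.

Section Pairing.
Variables (m n : nat) (C : comNzRingType) (F : m.-tuple 'I_n.+1 -> C).

Lemma pairingB (p q : {mpoly C[n]}) :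
  pairing (p - q) F = pairing p F - pairing q F.
Proof.
rewrite /pairing -sumrB; apply: eq_bigr => c _.
by rewrite mcoeffB mulrBl.
Qed.

Lemma pairing_sumZ (I : finType) (k : I -> C) (p : I -> {mpoly C[n]}) :
  pairing (\sum_i k i *: p i) F = \sum_i k i * pairing (p i) F.
Proof.
under [RHS]eq_bigr => i _ do rewrite /pairing mulr_sumr.
rewrite exchange_big /=; apply: eq_bigr => c _.
rewrite raddf_sum /= mulr_suml; apply: eq_bigr => i _.
by rewrite mcoeffZ mulrA.
Qed.

Lemma pairingX (c : 'X_{1..n}) :
  (mdeg c <= m)%N -> pairing 'X_[c] F = tcoef F c.
Proof.
rewrite -ltnS => lt_c; rewrite /pairing (bigD1 (BMultinom lt_c)) //=.
rewrite mcoeffX eqxx mul1r big1 ?addr0 // => d neq_dc.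
rewrite mcoeffX [c == _]eq_sym.
by have /negPf -> : bmnm d != c by []; rewrite mul0r.
Qed.

End Pairing.

Theorem proposition3p5 (R : realType) (m n r : nat)
    (m_ge1 : (1 <= m)%N) (n_ge1 : (1 <= n)%N) (r_ge1 : (1 <= r)%N)
    (F : m.-tuple 'I_n.+1 -> R[i]) (F_sym : symmetric_tensor F)
    (G : {ffun B0 n r * B1 n r -> R[i]}) (G_gen : generating_matrix F G)
    (a : B1 n r) (g : 'X_{1..n}) (deg_ag : (mdeg g + mdeg (val a) <= m)%N) :
  tcoef F (val a + g)%MM = \sum_(b : B0 n r) G (b, a) * tcoef F (val b + g)%MM.
Proof.
have Nk_g : Nk (m%:Z - (mdeg (val a))%:Z) g by rewrite /Nk lerBrDr.
have phiXE : phi G a * 'X_[g] =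
    \sum_(b : B0 n r) G (b, a) *: 'X_[(val b + g)%MM] - 'X_[(val a + g)%MM].
  rewrite /phi mulrBl mulr_suml -mpolyXD; congr (_ - _).
  by apply: eq_bigr => b _; rewrite -scalerAl -mpolyXD.
have /eqP := G_gen a g Nk_g.
rewrite phiXE pairingB subr_eq0 pairing_sumZ => /eqP eq_pairing.
rewrite -pairingX; last by rewrite mdegD addnC.
rewrite -eq_pairing; apply: eq_bigr => b _; rewrite pairingX //.
rewrite mdegD addnC; apply: leq_trans deg_ag.
by rewrite leq_add2l mdeg_B0_le_B1.
Qed.
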